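(* Let $\epsilon\ge0$, $\kappa\ge0$, $n\ge1$, and let $\mathcal{A}=(\mathcal{N}\circ\mathcal{C}_n)\circ\cdots\circ(\mathcal{N}\circ\mathcal{C}_1)$, where $\mathcal{N}$ and $\mathcal{C}_1,\dots,\mathcal{C}_n$ are quantum channels with compatible input and output spaces. Declare two input states neighbouring, $\rho\sim\sigma$, if $\frac12\|\rho-\sigma\|_1\le\kappa$. Then $\mathcal{A}$ is $(\epsilon,\delta)$-differentially private with $$\delta=\big(\eta_{e^\epsilon}(\mathcal{N})\big)^n\kappa.$$
   Context: All Hilbert spaces are finite-dimensional. A quantum channel is a completely positive trace-preserving map. $\mathcal{A}$ is $(\epsilon,\delta)$-differentially private if for all operators $0\le M\le I$ and all input quantum states $\rho\sim\sigma$, $\operatorname{Tr}(M\mathcal{A}(\rho))\le e^\epsilon\operatorname{Tr}(M\mathcal{A}(\sigma))+\delta$. For $\gamma\ge1$, $E_\gamma(\rho\|\sigma)=\operatorname{Tr}(\rho-\gamma\sigma)^+$, where $X^+$ is the positive part of a Hermitian operator $X$, and the contraction coefficient is $\eta_\gamma(\mathcal{N})=\sup_{\rho,\sigma}E_\gamma(\mathcal{N}(\rho)\|\mathcal{N}(\sigma))/E_\gamma(\rho\|\sigma)$ over quantum states $\rho,\sigma$ with $E_\gamma(\rho\|\sigma)>0$. *)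

(* Defs.v *)
From HB Require Import structures.
From mathcomp Require Import all_boot all_order all_algebra.
From mathcomp Require Import sesquilinear spectral.
From mathcomp Require Import complex.
From mathcomp Require mxtens.
From mathcomp Require Import all_classical all_reals all_analysis.

Set Implicit Arguments.
Unset Strict Implicit.
Unset Printing Implicit Defensive.

Import Order.TTheory GRing.Theory Num.Theory.

Local Open Scope ring_scope.
Local Open Scope classical_set_scope.
Local Open Scope complex_scope.
Local Open Scope sesquilinear_scope.

(* A d-dimensional Hilbert space is represented by C^d, with C = R[i], and its
   operators by 'M[R[i]]_d. *)

(* The order of R[i] is partial: 0 <= z says that z is real and nonnegative. In
   particular psdmx A forces A to be Hermitian. *)
Definition psdmx (R : realType) d (A : 'M[R[i]]_d) : Prop :=
  forall v : 'cV[R[i]]_d, 0 <= (v^t* *m A *m v) 0 0.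

Definition lemx (R : realType) d (A B : 'M[R[i]]_d) : Prop := psdmx (B - A).

Definition quantum_state (R : realType) d (rho : 'M[R[i]]_d) : Prop :=
  psdmx rho /\ \tr rho = 1.

(* The (i, j) block, of size d x d, of an operator on C^k (x) C^d. *)
Definition tensblock (R : realType) k d (X : 'M[R[i]]_(k * d)) (i j : 'I_k) :
    'M[R[i]]_d :=
  \matrix_(a, b) X (mxtens.mxtens_index (i, a)) (mxtens.mxtens_index (j, b)).

(* id_k (x) Phi, since X = \sum_(i, j) E_ij (x) X_ij. *)
Definition ampliation (R : realType) k d d'
    (Phi : 'M[R[i]]_d -> 'M[R[i]]_d') (X : 'M[R[i]]_(k * d)) :
    'M[R[i]]_(k * d') :=
  \sum_(i < k) \sum_(j < k) mxtens.tensmx (delta_mx i j) (Phi (tensblock X i j)).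

Definition completely_positive (R : realType) d d'
    (Phi : 'M[R[i]]_d -> 'M[R[i]]_d') : Prop :=
  forall (k : nat) (X : 'M[R[i]]_(k * d)), psdmx X -> psdmx (ampliation Phi X).

Definition trace_preserving (R : realType) d d'
    (Phi : 'M[R[i]]_d -> 'M[R[i]]_d') : Prop :=
  forall X, \tr (Phi X) = \tr X.

Definition quantum_channel (R : realType) d d'
    (Phi : {linear 'M[R[i]]_d -> 'M[R[i]]_d'}) : Prop :=
  completely_positive Phi /\ trace_preserving Phi.

(* Functional calculus f(A), meaningful for Hermitian A: then
   A = P^-1 diag(l) P with P = spectralmx A unitary and l = spectral_diag A
   real. *)
Definition herm_fun (R : realType) d (f : R -> R) (A : 'M[R[i]]_d) :
    'M[R[i]]_d :=
  invmx (spectralmx A)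
    *m diag_mx (map_mx (fun l => (f (complex.Re l))%:C) (spectral_diag A))
    *m spectralmx A.

Definition pospart (R : realType) d (A : 'M[R[i]]_d) : 'M[R[i]]_d :=
  herm_fun (fun x => Num.max x 0) A.

(* Tr sqrt(X^* X) *)
Definition trace_norm (R : realType) d (X : 'M[R[i]]_d) : R :=
  complex.Re (\tr (herm_fun Num.sqrt (X^t* *m X))).

Definition hockey_stick (R : realType) d (gamma : R) (rho sigma : 'M[R[i]]_d) :
    R :=
  complex.Re (\tr (pospart (rho - gamma%:C *: sigma))).

(* For a channel and gamma >= 1 the ratios are bounded by 1. There is no pair
   of states with positive divergence exactly when d <= 1; the supremum is then
   sup set0 = 0. *)
Definition contraction_coeff (R : realType) d d' (gamma : R)
    (Phi : 'M[R[i]]_d -> 'M[R[i]]_d') : R :=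
  sup [set r : R | exists rho sigma : 'M[R[i]]_d,
    [/\ quantum_state rho, quantum_state sigma,
        0 < hockey_stick gamma rho sigma &
        r = hockey_stick gamma (Phi rho) (Phi sigma)
              / hockey_stick gamma rho sigma]].

(* The inequality is in R[i]; both traces are real. *)
Definition diff_private (R : realType) d d'
    (nbr : 'M[R[i]]_d -> 'M[R[i]]_d -> Prop) (epsilon delta : R)
    (A : 'M[R[i]]_d -> 'M[R[i]]_d') : Prop :=
  forall (M : 'M[R[i]]_d') (rho sigma : 'M[R[i]]_d),
    lemx 0 M -> lemx M 1%:M ->
    quantum_state rho -> quantum_state sigma -> nbr rho sigma ->
    \tr (M *m A rho) <= (expR epsilon)%:C * \tr (M *m A sigma) + delta%:C.

Definition trace_close (R : realType) d (kappa : R) (rho sigma : 'M[R[i]]_d) :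
    Prop :=
  2^-1 * trace_norm (rho - sigma) <= kappa.

(* Dimension of the space on which the (k+1)-st step acts: the input space for
   the first step, the output space of N afterwards. *)
Definition step_dim (din dout k : nat) : nat := if k is 0 then din else dout.

(* (N \o C_n) \o ... \o (N \o C_1), where C_(k+1) is written C k. *)
Fixpoint iterated_mechanism (R : realType) (din dmid dout : nat)
    (N : 'M[R[i]]_dmid -> 'M[R[i]]_dout)
    (C : forall k, 'M[R[i]]_(step_dim din dout k) -> 'M[R[i]]_dmid) (n : nat) :
    'M[R[i]]_din -> 'M[R[i]]_(step_dim din dout n) :=
  match n with
  | 0 => id
  | k.+1 => (N \o C k) \o iterated_mechanism N C k
  end.

(* Main.v *)
Require Import Defs.
From mathcomp Require Import all_boot all_order all_algebra.
From mathcomp Require Import sesquilinear spectral.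
From mathcomp Require Import complex.
From mathcomp Require mxtens.
From mathcomp Require Import lra.
From mathcomp Require Import all_classical all_reals all_analysis.

Set Implicit Arguments.
Unset Strict Implicit.
Unset Printing Implicit Defensive.

Import Order.TTheory GRing.Theory Num.Theory.

Local Open Scope ring_scope.
Local Open Scope complex_scope.
Local Open Scope sesquilinear_scope.

(* For a Hermitian X = X^+ - X^-, Tr X^+ is the maximum of Tr (M X) over
   0 <= M <= 1, attained at the spectral projection onto the positive part. This
   gives at once the privacy bound
   Tr (M A(rho)) - gamma Tr (M A(sigma)) <= E_gamma (A(rho) || A(sigma)), the
   monotonicity of E_gamma under channels, and
   E_gamma (rho || sigma) <= E_1 (rho || sigma) = 1/2 ||rho - sigma||_1 for
   gamma >= 1. By monotonicity each C_k does not increase E_gamma, and each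
   application of N multiplies it by at most the contraction coefficient. *)

Lemma mxtraceB (F : pzRingType) n (A B : 'M[F]_n) : \tr (A - B) = \tr A - \tr B.
Proof. exact: raddfB. Qed.

Lemma mxtrace_mulB (F : pzRingType) n (M P Q : 'M[F]_n) :
  \tr (M *m (P - Q)) = \tr (M *m P) - \tr (M *m Q).
Proof. by rewrite mulmxBr mxtraceB. Qed.

(** Splits the gap into two traces that are nonnegative when [0 <= M <= 1] and [P], [Q] are
    positive. It serves for the two parts of a Hermitian matrix and for their images under a
    channel. *)
Lemma mxtrace_sub_mul (F : pzRingType) n (M P Q : 'M[F]_n) :
  \tr P - \tr (M *m (P - Q)) = \tr ((1%:M - M) *m P) + \tr (M *m Q).
Proof. by rewrite mxtrace_mulB mulmxBl mul1mx mxtraceB opprB addrCA addrC. Qed.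

(** * Conjugate transposes and polarisation *)

Section Adjoint.
Variable (K : numClosedFieldType).

Lemma adjmxM m n p (A : 'M[K]_(m, n)) (B : 'M[K]_(n, p)) :
  (A *m B)^t* = B^t* *m A^t*.
Proof. by rewrite trmx_mul map_mxM. Qed.

Lemma adjmxD m n (A B : 'M[K]_(m, n)) : (A + B)^t* = A^t* + B^t*.
Proof. by rewrite linearD /= map_mxD. Qed.

Lemma adjmxN m n (A : 'M[K]_(m, n)) : (- A)^t* = - A^t*.
Proof. by rewrite linearN /= map_mxN. Qed.

Lemma adjmxZ m n c (A : 'M[K]_(m, n)) : (c *: A)^t* = c^* *: A^t*.
Proof. by rewrite linearZ /= map_mxZ. Qed.

Lemma adjmx_delta m n (i : 'I_m) (j : 'I_n) :
  (delta_mx i j : 'M[K]_(m, n))^t* = delta_mx j i.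
Proof. by rewrite trmx_delta map_delta_mx. Qed.

Lemma mulmx_delta_entry n (A : 'M[K]_n) (i j : 'I_n) :
  ((delta_mx i 0 : 'cV[K]_n)^t* *m A *m (delta_mx j 0 : 'cV[K]_n)) 0 0 = A i j.
Proof. by rewrite adjmx_delta -rowE -colE !mxE. Qed.

(** Polarisation: expanding at [u + v] gives [f u v + f v u = 0], and replacing [v] by ['i *: v]
    gives [f u v = f v u]. Hence [f] vanishes, and its values on basis vectors are the entries of
    [B]. *)
Lemma mxform_eq0 n (B : 'M[K]_n) :
  (forall v : 'cV[K]_n, (v^t* *m B *m v) 0 0 = 0) -> B = 0.
Proof.
move=> B0; pose f (u v : 'cV[K]_n) := (u^t* *m B *m v) 0 0.
have fD u v : f u v + f v u = 0.
  have addE (X Y : 'M[K]_1) : (X + Y) 0 0 = X 0 0 + Y 0 0 by rewrite mxE.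
  have := B0 (u + v); rewrite adjmxD !mulmxDl !mulmxDr !addE.
  by rewrite !B0 addr0 add0r addrC.
apply/matrixP => i j; rewrite [RHS]mxE -[LHS]mulmx_delta_entry -/(f _ _).
set u := delta_mx i 0; set v := delta_mx j 0.
have := fD u ('i *: v); rewrite /f adjmxZ conjCi -!scalemxAl -scalemxAr.
rewrite [X in X + _]mxE [X in _ + X]mxE -/(f u v) -/(f v u) mulNr -mulrBr.
move/eqP; rewrite mulf_eq0 (negPf (neq0Ci _)) /= subr_eq0 => /eqP fC.
have := fD u v; rewrite -fC -mulr2n => /eqP.
by rewrite mulrn_eq0 /= => /eqP.
Qed.

End Adjoint.

(** * Diagonalised matrices and their spectra *)

Section Diagonalised.
Variables (F : fieldType) (n : nat).
Implicit Types (P : 'M[F]_n) (l : 'rV[F]_n).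

Definition diagonalised P l : 'M[F]_n := invmx P *m diag_mx l *m P.

Lemma diagonalisedM P l l' : P \in unitmx ->
  diagonalised P l *m diagonalised P l' =
  diagonalised P (\row_i (l 0 i * l' 0 i)).
Proof.
move=> Pu; rewrite /diagonalised !mulmxA mulmxK//.
by rewrite -[X in X *m _ = _]mulmxA mulmx_diag.
Qed.

Lemma diagonalisedB P l l' :
  diagonalised P l - diagonalised P l' = diagonalised P (l - l').
Proof. by rewrite /diagonalised -mulmxBl -mulmxBr -raddfB. Qed.

Lemma diagonalised1 P : P \in unitmx -> diagonalised P (const_mx 1) = 1%:M.
Proof. by move=> Pu; rewrite /diagonalised diag_const_mx mulmx1 mulVmx. Qed.

Lemma trace_diagonalised P l : P \in unitmx ->
  \tr (diagonalised P l) = \sum_i l 0 i.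
Proof.
move=> Pu; rewrite /diagonalised mxtrace_mulC mulmxA mulmxV// mul1mx.
exact: mxtrace_diag.
Qed.

(** Conjugation by [P] fixes the scalar matrix ['X] and cancels in the determinant. *)
Lemma char_poly_diagonalised P l : P \in unitmx ->
  char_poly (diagonalised P l) = \prod_(x <- [seq l 0 i | i : 'I_n]) ('X - x%:P).
Proof.
move=> Pu; transitivity (char_poly (diag_mx l)); last first.
  rewrite char_poly_trig ?diag_mx_is_trig// big_image /=.
  by apply: eq_bigr => i _; rewrite mxE eqxx mulr1n.
rewrite /char_poly.
have -> : char_poly_mx (diagonalised P l) =
    map_mx polyC (invmx P) *m char_poly_mx (diag_mx l) *m map_mx polyC P.
  rewrite /char_poly_mx mulmxBr mulmxBl !map_mxM; congr (_ - _).
  by rewrite scalar_mxC -mulmxA -map_mxM mulVmx// map_mx1 mulmx1.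
rewrite !det_mulmx mulrAC -det_mulmx -map_mxM mulVmx//.
by rewrite map_mx1 det1 mul1r.
Qed.

End Diagonalised.

Lemma diagonalised_unitary (K : numClosedFieldType) n
    (P : 'M[K]_n) (l : 'rV[K]_n) :
  P \is unitarymx -> diagonalised P l = P^t* *m diag_mx l *m P.
Proof. by move=> Pu; rewrite /diagonalised invmx_unitary. Qed.

Lemma diagonalised_adj (K : numClosedFieldType) n (P : 'M[K]_n) (l : 'rV[K]_n) :
  P \is unitarymx -> (forall i, l 0 i \is Num.real) ->
  (diagonalised P l)^t* = diagonalised P l.
Proof.
move=> Pu lr; rewrite diagonalised_unitary// !adjmxM trmxCK mulmxA.
congr (_ *m _ *m _); apply/matrixP => i j; rewrite !mxE rmorphMn /= eq_sym.
by case: eqP => [->|//]; rewrite (CrealP _).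
Qed.

Lemma hermitian_diagonalised (K : numClosedFieldType) n (A : 'M[K]_n) :
  A^t* = A -> A = diagonalised (spectralmx A) (spectral_diag A) /\
    forall i, spectral_diag A 0 i \is Num.real.
Proof.
move=> Ah; have Aherm : A \is hermsymmx.
  by apply/is_hermitianmxP; rewrite expr0 scale1r Ah.
split; first exact/orthomx_spectralP/hermitian_normalmx.
by move=> i; apply/mxOverP/hermitian_spectral_diag_real.
Qed.

(** * Positive semidefinite matrices *)

Section Psd.
Variable (R : realType).
Local Notation K := R[i].

Lemma psdmx_conj m n (A : 'M[K]_m) (B : 'M[K]_(m, n)) :
  psdmx A -> psdmx (B^t* *m A *m B).
Proof. by move=> A0 v; have := A0 (B *m v); rewrite adjmxM !mulmxA. Qed.

Lemma psdmx_diag n (l : 'rV[K]_n) :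
  (forall i, 0 <= l 0 i) -> psdmx (diag_mx l).
Proof.
move=> l0 v; rewrite mul_mx_diag mxE; apply: sumr_ge0 => i _.
by rewrite !mxE mulrAC mulr_ge0// mulrC mul_conjC_ge0.
Qed.

Lemma psdmx_diagonal n (A : 'M[K]_n) i : psdmx A -> 0 <= A i i.
Proof. by move=> /(_ (delta_mx i 0)); rewrite mulmx_delta_entry. Qed.

(** Nonnegative elements of [R[i]] are real, so [A] and its adjoint have the same quadratic form;
    polarisation then identifies them. *)
Lemma psdmx_adj n (A : 'M[K]_n) : psdmx A -> A^t* = A.
Proof.
move=> A0; apply/esym/eqP; rewrite -subr_eq0; apply/eqP/mxform_eq0 => v.
have subE (X Y : 'M[K]_1) : (X - Y) 0 0 = X 0 0 - Y 0 0 by rewrite !mxE.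
rewrite mulmxBr mulmxBl subE; apply/eqP; rewrite subr_eq0; apply/eqP.
have /ger0_real /CrealP <- := A0 v.
transitivity (((v^t* *m A *m v)^t*) 0 0); first by rewrite !mxE.
by rewrite !adjmxM trmxCK mulmxA.
Qed.

Lemma psdmxB_adj n (A B : 'M[K]_n) : psdmx A -> psdmx B ->
  (A - B)^t* = A - B.
Proof. by move=> A0 B0; rewrite adjmxD adjmxN (psdmx_adj A0) (psdmx_adj B0). Qed.

End Psd.

(** * Functional calculus of Hermitian matrices *)

Section Hermitian.
Variables (R : realType) (n : nat).
Local Notation K := R[i].
Implicit Types A M : 'M[K]_n.

Definition eigval A : 'rV[R]_n := map_mx (@complex.Re R) (spectral_diag A).

Definition fun_eigval (f : R -> R) A : 'rV[K]_n := \row_i (f (eigval A 0 i))%:C.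

Lemma herm_funE f A :
  herm_fun f A = diagonalised (spectralmx A) (fun_eigval f A).
Proof.
have <- : map_mx (fun l => (f (complex.Re l))%:C) (spectral_diag A) =
    fun_eigval f A by apply/rowP => i; rewrite !mxE.
by [].
Qed.

Lemma fun_eigval_real f A i : fun_eigval f A 0 i \is Num.real.
Proof. by rewrite mxE complex_real. Qed.

Lemma herm_fun_adj f A : (herm_fun f A)^t* = herm_fun f A.
Proof.
rewrite herm_funE; apply: diagonalised_adj (spectral_unitarymx A) _.
exact: fun_eigval_real.
Qed.

Lemma herm_fun_id A : A^t* = A -> herm_fun id A = A.
Proof.
move=> /hermitian_diagonalised[AE lr]; rewrite [RHS]AE herm_funE.
have -> : fun_eigval id A = spectral_diag A.
  by apply/rowP => i; rewrite !mxE; exact: RRe_real.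
by [].
Qed.

Lemma herm_funM f g A :
  herm_fun f A *m herm_fun g A = herm_fun (fun x => f x * g x) A.
Proof.
rewrite !herm_funE (diagonalisedM _ _ (spectral_unit A)).
have -> : \row_i (fun_eigval f A 0 i * fun_eigval g A 0 i) =
    fun_eigval (fun x => f x * g x) A.
  by apply/rowP => i; rewrite !mxE rmorphM.
by [].
Qed.

Lemma herm_funB f g A :
  herm_fun f A - herm_fun g A = herm_fun (fun x => f x - g x) A.
Proof.
rewrite !herm_funE diagonalisedB.
have -> : fun_eigval f A - fun_eigval g A = fun_eigval (fun x => f x - g x) A.
  by apply/rowP => i; rewrite !mxE rmorphB.
by [].
Qed.

Lemma herm_fun1 A : herm_fun (fun=> 1) A = 1%:M.
Proof.
rewrite herm_funE -(diagonalised1 (spectral_unit A)).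
have -> : fun_eigval (fun=> 1) A = const_mx 1.
  by apply/rowP => i; rewrite !mxE.
by [].
Qed.

Lemma eq_herm_fun f g A : f =1 g -> herm_fun f A = herm_fun g A.
Proof. by move=> /funext ->. Qed.

Lemma trace_herm_fun f A : \tr (herm_fun f A) = (\sum_i f (eigval A 0 i))%:C.
Proof.
rewrite herm_funE (trace_diagonalised _ (spectral_unit A)) rmorph_sum.
by apply: eq_bigr => i _; rewrite mxE.
Qed.

(* The spectrum of herm_fun f A is read off its characteristic polynomial, so
   it does not depend on the diagonalisation chosen by spectralmx. *)
Lemma trace_herm_fun_comp f g A :
  \tr (herm_fun g (herm_fun f A)) = (\sum_i g (f (eigval A 0 i)))%:C.
Proof.
set B := herm_fun f A; rewrite trace_herm_fun; congr (_%:C).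
have [BE _] := hermitian_diagonalised (herm_fun_adj f A : B^t* = B).
have eqv : perm_eq [seq spectral_diag B 0 i | i : 'I_n]
                   [seq fun_eigval f A 0 i | i : 'I_n].
  apply: prod_XsubC_eq.
  rewrite -(char_poly_diagonalised _ (spectral_unit B)).
  by rewrite -(char_poly_diagonalised _ (spectral_unit A)) -BE -herm_funE.
transitivity
    (\sum_(z <- [seq spectral_diag B 0 i | i : 'I_n]) g (complex.Re z)).
  by rewrite big_image /=; apply: eq_bigr => i _; rewrite mxE.
rewrite (perm_big _ eqv) big_image /=.
by apply: eq_bigr => i _; rewrite mxE.
Qed.

Lemma psdmx_herm_fun f A : (forall x, 0 <= f x) -> psdmx (herm_fun f A).
Proof.
move=> f0; rewrite herm_funE (diagonalised_unitary _ (spectral_unitarymx A)).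
by apply: psdmx_conj; apply: psdmx_diag => i; rewrite mxE ler0c.
Qed.

(** In an eigenbasis of [A], the trace is the sum of the diagonal entries of [M], each weighted by
    an eigenvalue of [A]; all these factors are nonnegative. *)
Lemma psdmx_trace_mul_ge0 M A : psdmx M -> psdmx A -> 0 <= \tr (M *m A).
Proof.
move=> M0 A0; have [AE _] := hermitian_diagonalised (psdmx_adj A0).
move: AE; set U := spectralmx A; set D := spectral_diag A => AE.
have Uu : U \is unitarymx := spectral_unitarymx A.
rewrite diagonalised_unitary// in AE.
have D0 : psdmx (diag_mx D).
  have := psdmx_conj (U^t*) A0; rewrite trmxCK AE !mulmxA.
  by rewrite (unitarymxP Uu) mul1mx mulmxtVK.
have UMU0 : psdmx (U *m M *m U^t*).
  by have := psdmx_conj (U^t*) M0; rewrite trmxCK.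
rewrite AE !mulmxA mxtrace_mulC !mulmxA mul_mx_diag; apply: sumr_ge0 => i _.
rewrite mxE; apply: mulr_ge0; first exact: psdmx_diagonal UMU0.
by have := psdmx_diagonal i D0; rewrite mxE eqxx mulr1n.
Qed.

End Hermitian.

(** * Variational characterisation of the positive part *)

Section PositivePart.
Variables (R : realType) (n : nat).
Local Notation K := R[i].
Implicit Types A M : 'M[K]_n.

Definition negpart A : 'M[K]_n := herm_fun (fun x => Num.max (- x) 0) A.

Lemma psdmx_pospart A : psdmx (pospart A).
Proof. by apply: psdmx_herm_fun => x; rewrite le_max lexx orbT. Qed.

Lemma psdmx_negpart A : psdmx (negpart A).
Proof. by apply: psdmx_herm_fun => x; rewrite le_max lexx orbT. Qed.

Lemma pospartB A : A^t* = A -> pospart A - negpart A = A.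
Proof.
move=> Ah; rewrite herm_funB -[RHS](herm_fun_id Ah); apply: eq_herm_fun => x.
by case: (leP x 0) => x0; case: (leP (- x) 0) => //; lra.
Qed.

Lemma trace_mul_le_pospart M A : lemx 0 M -> lemx M 1%:M -> A^t* = A ->
  \tr (M *m A) <= \tr (pospart A).
Proof.
rewrite /lemx subr0 => M0 M1 Ah; rewrite -subr_ge0.
rewrite -{2}(pospartB Ah) mxtrace_sub_mul; apply: addr_ge0.
  exact: psdmx_trace_mul_ge0 M1 (psdmx_pospart A).
exact: psdmx_trace_mul_ge0 M0 (psdmx_negpart A).
Qed.

Lemma trace_pospart_attained A : A^t* = A ->
  exists M, [/\ lemx 0 M, lemx M 1%:M & \tr (M *m A) = \tr (pospart A)].
Proof.
(* The indicator of [0 < x] multiplied by [x] is [Num.max x 0], so this projection times [A] is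
   exactly [pospart A]. *)
move=> Ah; exists (herm_fun (fun x => if 0 < x then 1 else 0) A); split.
- by rewrite /lemx subr0; apply: psdmx_herm_fun => x; case: ifP.
- rewrite /lemx -(herm_fun1 A) herm_funB; apply: psdmx_herm_fun => x.
  by case: ifP; rewrite ?subrr ?subr0.
- congr (\tr _); rewrite -[X in _ *m X](herm_fun_id Ah) herm_funM.
  by apply: eq_herm_fun => x; case: ltP; rewrite ?mul1r ?mul0r.
Qed.

End PositivePart.

(** * Trace norm and eigenvalues *)

Section TraceNorm.
Variable (R : realType).
Local Notation K := R[i].

Lemma trace_norm_herm n (A : 'M[K]_n) : A^t* = A ->
  trace_norm A = \sum_i `|eigval A 0 i|.
Proof.
(* [A *m A] becomes the square function applied to [A], so the trace of its square root is a sum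
   over the eigenvalues of [A], whichever eigenbasis is chosen for the square. *)
move=> Ah; rewrite /trace_norm Ah -{1 2}(herm_fun_id Ah) herm_funM.
rewrite trace_herm_fun_comp /=; apply: eq_bigr => i _.
by rewrite -expr2 sqrtr_sqr.
Qed.

(** Termwise, [Num.max x 0] is half of [x + |x|], and the [x] terms sum to zero. *)
Lemma sum_max0_half (I : finType) (x : I -> R) : \sum_i x i = 0 ->
  \sum_i Num.max (x i) 0 = 2^-1 * \sum_i `|x i|.
Proof.
move=> x0; rewrite -[X in _ = _ * X]addr0 -[X in _ * (_ + X)]x0 -big_split /=.
rewrite mulr_sumr; apply: eq_bigr => i _.
by case: (leP (x i) 0) => xi; [rewrite ler0_norm|rewrite gtr0_norm]; lra.
Qed.

Lemma trace_pospart_traceless n (A : 'M[K]_n) : A^t* = A -> \tr A = 0 ->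
  \tr (pospart A) = (2^-1 * trace_norm A)%:C.
Proof.
move=> Ah trA; rewrite trace_norm_herm// trace_herm_fun; congr (_%:C).
apply: sum_max0_half; apply: complexI.
by rewrite -(trace_herm_fun id) herm_fun_id.
Qed.

End TraceNorm.

(** * Positivity and monotonicity of channels *)

Section Channels.
Variable (R : realType).
Local Notation K := R[i].

Definition positive_map d d' (Phi : 'M[K]_d -> 'M[K]_d') : Prop :=
  forall X, psdmx X -> psdmx (Phi X).

(* Complete positivity is used on C^1 (x) C^d only; there the index set
   'I_(1 * d) has to be relabelled since 1 * d is not convertible to d. *)
Lemma completely_positive_positive d d' (Phi : 'M[K]_d -> 'M[K]_d') :
  completely_positive Phi -> positive_map Phi.
Proof.
move=> cp X X0.
pose e d (a : 'I_(1 * d)) := (mxtens.mxtens_unindex a).2.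
pose h d (a : 'I_d) : 'I_(1 * d) := mxtens.mxtens_index (0, a).
have hK k : cancel (@h k) (@e k) by move=> a; rewrite /e mxtens.mxtens_indexK.
have eK k : cancel (@e k) (@h k).
  move=> a; rewrite /e /h -[RHS]mxtens.mxtens_unindexK.
  by congr mxtens.mxtens_index; case: mxtens.mxtens_unindex => i j; rewrite ord1.
have blockE k (Z : 'M[K]_k) (Y : 'M[K]_(1 * k)) (v : 'cV[K]_k) (w : 'cV[K]_(1 * k)) :
    (forall a b, Y (h _ a) (h _ b) = Z a b) -> (forall a, w (h _ a) 0 = v a 0) ->
    (w^t* *m Y *m w) 0 0 = (v^t* *m Z *m v) 0 0.
  move=> YZ wv; have hbij : {on [pred _ | true], bijective (@h k)}.
    by exists (@e k) => a _; rewrite ?hK ?eK.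
  rewrite !mxE (reindex _ hbij) /=; apply: eq_bigr => a _; rewrite wv; congr (_ * _).
  rewrite !mxE (reindex _ hbij) /=; apply: eq_bigr => b _.
  by rewrite !mxE wv YZ.
have Y0 : psdmx (\matrix_(a, b) X (e _ a) (e _ b) : 'M[K]_(1 * d)).
  move=> w; rewrite (@blockE _ X _ (\col_a w (h _ a) 0))//.
  - by move=> a b; rewrite mxE !hK.
  - by move=> a; rewrite mxE.
move=> v; have := cp 1%N _ Y0 (\col_a v (e _ a) 0).
rewrite (@blockE _ (Phi X) _ v)//; last by move=> a; rewrite mxE hK.
(* For [k = 1] the double sum has a single term, whose first tensor factor is the 1 by 1
   identity. *)
move=> a b; rewrite /ampliation !big_ord1 mxtens.tensmxE mxE !eqxx mul1r.
congr (Phi _ _ _); apply/matrixP => i j; rewrite !mxE.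
by rewrite (hK _ i) (hK _ j).
Qed.

Lemma quantum_channel_state d d' (Phi : {linear 'M[K]_d -> 'M[K]_d'}) rho :
  quantum_channel Phi -> quantum_state rho -> quantum_state (Phi rho).
Proof.
move=> [/completely_positive_positive Pp Pt] [r0 r1].
by split; [exact: Pp|rewrite Pt].
Qed.

(** With [Q] optimal for [Phi A], positivity of [Phi] bounds [\tr (Q *m Phi A)] by
    [\tr (Phi (pospart A))], and [Phi] preserves that trace. *)
Lemma trace_pospart_channel d d' (Phi : {linear 'M[K]_d -> 'M[K]_d'}) A :
  quantum_channel Phi -> A^t* = A ->
  \tr (pospart (Phi A)) <= \tr (pospart A).
Proof.
move=> [/completely_positive_positive Pp Pt] Ah.
have p0 := Pp _ (psdmx_pospart A); have n0 := Pp _ (psdmx_negpart A).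
have PhiAE : Phi A = Phi (pospart A) - Phi (negpart A).
  by rewrite -linearB pospartB.
have PhiAh : (Phi A)^t* = Phi A by rewrite PhiAE; exact: psdmxB_adj.
have [Q [Q0 Q1 <-]] := trace_pospart_attained PhiAh.
rewrite -[leRHS]Pt -subr_ge0 PhiAE mxtrace_sub_mul.
move: Q0; rewrite /lemx subr0 => Q0; apply: addr_ge0.
  exact: psdmx_trace_mul_ge0 Q1 p0.
exact: psdmx_trace_mul_ge0 Q0 n0.
Qed.

End Channels.

(** * Hockey-stick divergence and its contraction *)

Section HockeyStick.
Variable (R : realType).
Local Notation K := R[i].

Lemma adjmx_state_diff d gamma (rho sigma : 'M[K]_d) :
  quantum_state rho -> quantum_state sigma ->
  (rho - gamma%:C *: sigma)^t* = rho - gamma%:C *: sigma.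
Proof.
move=> [r0 _] [s0 _]; rewrite adjmxD adjmxN adjmxZ (psdmx_adj r0) (psdmx_adj s0).
by rewrite (conjc_real gamma : (gamma%:C)^*%R = _).
Qed.

(** The trace is already real, so taking [complex.Re] loses nothing and inequalities can be moved
    between [R] and [R[i]]. *)
Lemma hockey_stickE d gamma (rho sigma : 'M[K]_d) :
  (hockey_stick gamma rho sigma)%:C = \tr (pospart (rho - gamma%:C *: sigma)).
Proof. by rewrite /hockey_stick trace_herm_fun. Qed.

Lemma hockey_stick_ge0 d gamma (rho sigma : 'M[K]_d) :
  0 <= hockey_stick gamma rho sigma.
Proof.
rewrite /hockey_stick trace_herm_fun; apply: sumr_ge0 => i _.
by rewrite le_max lexx orbT.
Qed.

Lemma hockey_stick_channel d d' (Phi : {linear 'M[K]_d -> 'M[K]_d'}) gamma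
    rho sigma :
  quantum_channel Phi -> quantum_state rho -> quantum_state sigma ->
  hockey_stick gamma (Phi rho) (Phi sigma) <= hockey_stick gamma rho sigma.
Proof.
move=> Pc rs ss; rewrite -lecR !hockey_stickE -linearZ -linearB.
exact/trace_pospart_channel/adjmx_state_diff.
Qed.

(** The optimal test [Q] for [rho - gamma sigma] also tests the traceless [rho - sigma], where its
    value is no smaller because [\tr (Q *m sigma)] is nonnegative and [1 <= gamma]. *)
Lemma hockey_stick_le_trace_norm d gamma (rho sigma : 'M[K]_d) : 1 <= gamma ->
  quantum_state rho -> quantum_state sigma ->
  hockey_stick gamma rho sigma <= 2^-1 * trace_norm (rho - sigma).
Proof.
move=> g1 rs ss; rewrite -lecR hockey_stickE.
have [[r0 r1] [s0 s1]] := (rs, ss).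
have Ah : (rho - sigma)^t* = rho - sigma by exact: psdmxB_adj.
have trA : \tr (rho - sigma) = 0 by rewrite mxtraceB r1 s1 subrr.
rewrite -(trace_pospart_traceless Ah trA).
have [Q [Q0 Q1 <-]] := trace_pospart_attained (adjmx_state_diff gamma rs ss).
apply: le_trans (trace_mul_le_pospart Q0 Q1 Ah).
rewrite !mxtrace_mulB lerD2l lerN2 -scalemxAr mxtraceZ.
move: Q0; rewrite /lemx subr0 => Q0.
by apply: ler_peMl; [exact: psdmx_trace_mul_ge0 Q0 s0|rewrite lecR].
Qed.

Definition contraction_ratios d d' gamma (Phi : 'M[K]_d -> 'M[K]_d') : set R :=
  [set r : R | exists rho sigma : 'M[K]_d,
    [/\ quantum_state rho, quantum_state sigma,
        0 < hockey_stick gamma rho sigma &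
        r = hockey_stick gamma (Phi rho) (Phi sigma)
              / hockey_stick gamma rho sigma]].

Lemma contraction_ratio_ub d d' (Phi : {linear 'M[K]_d -> 'M[K]_d'}) gamma :
  quantum_channel Phi -> ubound (contraction_ratios gamma Phi) 1.
Proof.
move=> Pc _ [rho [sigma [rs ss E0 ->]]].
by rewrite ler_pdivrMr// mul1r hockey_stick_channel.
Qed.

Lemma contraction_coeff_ge0 d d' (Phi : 'M[K]_d -> 'M[K]_d') gamma :
  0 <= contraction_coeff gamma Phi.
Proof.
rewrite -[contraction_coeff _ _]/(sup (contraction_ratios gamma Phi)).
(* [Phi] is an arbitrary map here: if the ratios are empty or unbounded, [sup] takes its default
   value 0. Otherwise it dominates some nonnegative ratio. *)
have [[S0 Sub]|/sup_out ->] := pselect (has_sup (contraction_ratios gamma Phi)); last by [].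
have [r Sr] := S0; apply: le_trans (ub_le_sup Sub Sr).
by case: Sr => rho [sigma [_ _ _ ->]]; rewrite divr_ge0 ?hockey_stick_ge0.
Qed.

Lemma hockey_stick_contraction d d' (Phi : {linear 'M[K]_d -> 'M[K]_d'}) gamma
    rho sigma :
  quantum_channel Phi -> quantum_state rho -> quantum_state sigma ->
  hockey_stick gamma (Phi rho) (Phi sigma) <=
    contraction_coeff gamma Phi * hockey_stick gamma rho sigma.
Proof.
move=> Pc rs ss; have := hockey_stick_ge0 gamma rho sigma.
rewrite le_eqVlt => /predU1P[E0|E0].
  (* Zero divergence yields no ratio in the supremum; monotonicity under [Phi] bounds the left side
     by zero directly. *)
  by rewrite -E0 mulr0 E0 hockey_stick_channel.
rewrite -ler_pdivrMr//; apply: ub_le_sup; last by exists rho, sigma.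
by exists 1; exact: contraction_ratio_ub.
Qed.

(** The induction also carries the fact that the outputs are states, since monotonicity and
    contraction at the next step are stated for states only. *)
Lemma hockey_stick_iterated din dmid dout gamma
    (N : {linear 'M[K]_dmid -> 'M[K]_dout})
    (C : forall k : nat,
        {linear 'M[K]_(step_dim din dout k) -> 'M[K]_dmid}) n rho sigma :
  quantum_channel N -> (forall k, (k < n)%N -> quantum_channel (C k)) ->
  quantum_state rho -> quantum_state sigma ->
  let A := iterated_mechanism N C n in
  [/\ quantum_state (A rho), quantum_state (A sigma) &
      hockey_stick gamma (A rho) (A sigma) <=
        contraction_coeff gamma N ^+ n * hockey_stick gamma rho sigma].
Proof.
move=> Nc Cc rs ss /=; elim: n Cc => [|n IH] Cc /=.
  by rewrite expr0 mul1r.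
have [|Ar As le_n] := IH; first by move=> k /ltnW; exact: Cc.
have Cn : quantum_channel (C n) by exact: Cc.
have Cr := quantum_channel_state Cn Ar; have Cs := quantum_channel_state Cn As.
split; [exact: quantum_channel_state Cr|exact: quantum_channel_state Cs|].
apply: le_trans (hockey_stick_contraction gamma Nc Cr Cs) _.
rewrite exprS -mulrA ler_wpM2l ?contraction_coeff_ge0//.
exact: le_trans (hockey_stick_channel gamma Cn Ar As) le_n.
Qed.

End HockeyStick.

Theorem mainTheorem5 (R : realType) (epsilon kappa : R) (n : nat)
    (din dmid dout : nat)
    (N : {linear 'M[R[i]]_dmid -> 'M[R[i]]_dout})
    (C : forall k : nat,
        {linear 'M[R[i]]_(step_dim din dout k) -> 'M[R[i]]_dmid}) :
  0 <= epsilon -> 0 <= kappa -> (1 <= n)%N ->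
  quantum_channel N ->
  (forall k : nat, (k < n)%N -> quantum_channel (C k)) ->
  diff_private (trace_close kappa) epsilon
    (contraction_coeff (expR epsilon) N ^+ n * kappa)
    (iterated_mechanism N C n).
Proof.
move=> e0 k0 _ Nc Cc M rho sigma M0 M1 rs ss close.
have [Ar As le_n] := hockey_stick_iterated (expR epsilon) Nc Cc rs ss.
(* Moving the [expR epsilon] term to the left leaves the trace of [M] against one Hermitian matrix,
   which the variational bound controls. *)
rewrite -lerBlDl; set A := iterated_mechanism N C n in Ar As le_n *.
have -> : \tr (M *m A rho) - (expR epsilon)%:C * \tr (M *m A sigma) =
    \tr (M *m (A rho - (expR epsilon)%:C *: A sigma)).
  by rewrite mxtrace_mulB -scalemxAr mxtraceZ.
apply: le_trans (trace_mul_le_pospart M0 M1 (adjmx_state_diff _ Ar As)) _.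
rewrite -hockey_stickE lecR; apply: le_trans le_n _.
(* The power of the coefficient is nonnegative, so it remains to bound the input divergence by
   [kappa] through half the trace norm; this uses [1 <= expR epsilon]. *)
rewrite ler_wpM2l ?exprn_ge0 ?contraction_coeff_ge0//.
apply: le_trans close; apply: hockey_stick_le_trace_norm => //.
by rewrite -expR0 ler_expR.
Qed.
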